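(* Let $\gamma:[0,T]\to T^{*}S^{1}$ be a periodic integral curve of the Hamiltonian vector field $X_{H}$ with period $T\neq 0$. The holonomy group of the connection $\nabla$, restricted to the image $\mathrm{im}\,\gamma$ of $\gamma$, is trivial if and only if the action integral satisfies $$I_{\gamma}=\frac{1}{2\pi}\int_{0}^{T}\gamma^{*}\theta = n\hbar$$ for some $n\in\mathbb{Z}$.
   Context: $T^{*}S^{1}=\mathbb{R}\times(\mathbb{R}/2\pi\mathbb{Z})$ has coordinates $(p,\alpha)$, 1-form $\theta=p\,\mathrm{d}\alpha$ and symplectic form $\omega=\mathrm{d}\theta=\mathrm{d}p\wedge\mathrm{d}\alpha$. The Hamiltonian of the mathematical pendulum is $H(p,\alpha)=\tfrac12p^{2}-\cos\alpha+1$, with Hamiltonian vector field $X_{H}=-\sin\alpha\,\frac{\partial}{\partial p}+p\,\frac{\partial}{\partial\alpha}$. Here ''periodic integral curve with period $T\ne0$'' means a nonconstant integral curve with primitive (minimal) period $T>0$; its energy $e=H(\gamma(t))$ is then different from $0$ and $2$, and its image is a connected component of the level set $H^{-1}(e)$. $\hbar>0$ is a fixed constant. $L=\mathbb{C}\times T^{*}S^{1}\to T^{*}S^{1}$ is the trivial complex line bundle with trivializing section $\lambda_{0}(p,\alpha)=(1,(p,\alpha))$, and $\nabla$ is the connection on $L$ defined by $\nabla\lambda_{0}=-i\hbar^{-1}\theta\otimes\lambda_{0}$. Thus a curve $t\mapsto z(t)\lambda_{0}(\gamma(t))$ in $L$ over $\gamma$ is horizontal if and only if $\frac{\mathrm{d}z}{\mathrm{d}t}-i\hbar^{-1}\theta(\dot\gamma(t))\,z=0$.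 The holonomy group of $\nabla$ restricted to $\mathrm{im}\,\gamma$ is the group of parallel transport maps of the fiber of $L$ over a point of $\mathrm{im}\,\gamma$ along loops in $\mathrm{im}\,\gamma$ based at that point. *)

(* Defs.v *)
From Stdlib Require Import Reals Lra Lia ZArith.
From Stdlib Require Import FunctionalExtensionality PropExtensionality ClassicalEpsilon.
From Coquelicot Require Import Coquelicot.

Open Scope R_scope.

(* An element of R / 2 pi Z is a coset of 2 pi Z, as a subset of R. *)
Definition coset (a : R) : R -> Prop :=
  fun b => exists k : Z, b = a + 2 * PI * IZR k.

(* S1 is R / 2 pi Z and TS1 is its cotangent bundle, the cylinder T*S^1. *)
Definition S1 : Type := { A : R -> Prop | exists a, A = coset a }.

Definition angle (a : R) : S1 := exist _ (coset a) (ex_intro _ a eq_refl).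

(* A representative; only used inside functions invariant under 2 pi Z. *)
Definition rep (q : S1) : R :=
  proj1_sig (constructive_indefinite_description _ (proj2_sig q)).

Definition sinS (q : S1) : R := sin (rep q).
Definition cosS (q : S1) : R := cos (rep q).

Definition TS1 : Type := (R * S1)%type.

(* A tangent vector (vp, va) at a point of TS1 stands for
   vp d/dp + va d/dalpha; this frame trivializes the tangent bundle. *)
Definition tangent : Type := (R * R)%type.

Definition theta (x : TS1) (v : tangent) : R := fst x * snd v.

Definition omega (x : TS1) (v w : tangent) : R := fst v * snd w - fst w * snd v.

Definition hamiltonian (x : TS1) : R := / 2 * fst x ^ 2 - cosS (snd x) + 1.

Definition X_H (x : TS1) : tangent := (- sinS (snd x), fst x).

(* Derivative at t in [a, b], one-sided at the end points. *)
Definition is_derive_on {V : NormedModule R_AbsRing}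
    (a b : R) (f : R -> V) (t : R) (l : V) : Prop :=
  filterdiff f (within (fun s => a <= s <= b) (locally t)) (fun h => scal h l).

(* The angular component is differentiated through a local lift to R. Any two
   lifts differentiable at t differ by a constant of 2 pi Z near t. *)
Definition has_velocity (a b : R) (sigma : R -> TS1) (t : R) (v : tangent) : Prop :=
  is_derive_on a b (fun s => fst (sigma s)) t (fst v) /\
  exists lift : R -> R,
    within (fun s => a <= s <= b) (locally t)
      (fun s => snd (sigma s) = angle (lift s)) /\
    is_derive_on a b lift t (snd v).

Definition velocity (a b : R) (sigma : R -> TS1) (t : R) : tangent :=
  epsilon (inhabits (0, 0)) (has_velocity a b sigma t).

Definition C1_on (sigma : R -> TS1) (a b : R) : Prop :=
  (forall t, a <= t <= b -> has_velocity a b sigma t (velocity a b sigma t)) /\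
  continuous_on (fun t => a <= t <= b)
    (velocity a b sigma : R -> prod_UniformSpace R_UniformSpace R_UniformSpace).

(* [a, b] is cut into finitely many intervals of positive length on each of
   which P holds. *)
Inductive piecewise (P : R -> R -> Prop) : R -> R -> Prop :=
| piecewise_one a b : a < b -> P a b -> piecewise P a b
| piecewise_cat a c b : piecewise P a c -> piecewise P c b -> piecewise P a b.

Definition integral_curve (X : TS1 -> tangent) (gamma : R -> TS1) (a b : R) : Prop :=
  forall t, a <= t <= b -> has_velocity a b gamma t (X (gamma t)).

(* s is a period of a curve defined on [0, T]. For s = T this only says that
   the curve is closed. *)
Definition is_period (T : R) (gamma : R -> TS1) (s : R) : Prop :=
  0 < s <= T /\ forall t, 0 <= t <= T - s -> gamma (t + s) = gamma t.

(* A curve [0, T] -> TS1 is represented by a function on R of which only the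
   values on [0, T] are used. *)
Definition periodic_integral_curve
    (X : TS1 -> tangent) (gamma : R -> TS1) (T : R) : Prop :=
  integral_curve X gamma 0 T /\
  (exists t, 0 <= t <= T /\ gamma t <> gamma 0) /\
  is_period T gamma T /\
  (forall s, is_period T gamma s -> T <= s).

Definition im (gamma : R -> TS1) (T : R) (x : TS1) : Prop :=
  exists t, 0 <= t <= T /\ x = gamma t.

Definition pullback (beta : TS1 -> tangent -> R) (a b : R) (gamma : R -> TS1)
    (t : R) : R :=
  beta (gamma t) (velocity a b gamma t).

Definition action (gamma : R -> TS1) (T : R) : R :=
  / (2 * PI) * RInt (pullback theta 0 T gamma) 0 T.

Definition L : Type := (C * TS1)%type.

Definition lambda0 (x : TS1) : L := (RtoC 1, x).

Definition scalL (z : C) (l : L) : L := (Cmult z (fst l), snd l).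

Definition fibre (x : TS1) : Type := { l : L | snd l = x }.

(* nabla lambda0 = connection_form (x) lambda0. *)
Definition connection_form (hbar : R) (x : TS1) (v : tangent) : C :=
  (- (Ci * / RtoC hbar * RtoC (theta x v)))%C.

(* The covariant derivative of t |-> z t * lambda0 (sigma t) vanishes on [a, b]. *)
Definition horizontal_on (hbar : R) (sigma : R -> TS1) (z : R -> C) (a b : R) : Prop :=
  C1_on sigma a b /\
  forall t, a <= t <= b ->
    exists dz : C,
      is_derive_on (V := C_R_NormedModule) a b z t dz /\
      (dz + connection_form hbar (sigma t) (velocity a b sigma t) * z t)%C = RtoC 0.

Definition parallel_transport (hbar : R) (sigma : R -> TS1) (a b : R) (u w : L) : Prop :=
  exists z : R -> C,
    piecewise (horizontal_on hbar sigma z) a b /\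
    u = scalL (z a) (lambda0 (sigma a)) /\
    w = scalL (z b) (lambda0 (sigma b)).

Definition loop_in (D : TS1 -> Prop) (x : TS1) (sigma : R -> TS1) : Prop :=
  piecewise (C1_on sigma) 0 1 /\
  (forall t, 0 <= t <= 1 -> D (sigma t)) /\
  sigma 0 = x /\ sigma 1 = x.

Definition holonomy_group (hbar : R) (D : TS1 -> Prop) (x : TS1)
    (g : fibre x -> fibre x) : Prop :=
  exists sigma : R -> TS1,
    loop_in D x sigma /\
    forall u : fibre x,
      parallel_transport hbar sigma 0 1 (proj1_sig u) (proj1_sig (g u)).

Definition trivial_holonomy (hbar : R) (D : TS1 -> Prop) (x : TS1) : Prop :=
  forall g : fibre x -> fibre x,
    holonomy_group hbar D x g <-> g = (fun u => u).

Lemma angle_eq (a b : R) :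
  angle a = angle b <-> exists k : Z, b = a + 2 * PI * IZR k.
Proof.
split.
- intros E. apply (f_equal (@proj1_sig _ _)) in E. simpl in E.
  change (coset a b). rewrite E. exists 0%Z. simpl; ring.
- intros [k ->].
  assert (E : coset a = coset (a + 2 * PI * IZR k)).
  { apply functional_extensionality; intros c. apply propositional_extensionality.
    split; intros [m ->].
    - exists (m - k)%Z. rewrite minus_IZR; ring.
    - exists (k + m)%Z. rewrite plus_IZR; ring. }
  unfold angle. generalize (ex_intro (fun a0 => coset a = coset a0) a eq_refl).
  rewrite E. intros e. f_equal. apply proof_irrelevance.
Qed.

Lemma angle_rep (q : S1) : angle (rep q) = q.
Proof.
unfold rep. destruct constructive_indefinite_description as [a Ha]; simpl.
destruct q as [A e]; simpl in *. subst A. unfold angle. f_equal.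
apply proof_irrelevance.
Qed.

Lemma rep_angle (a : R) : exists k : Z, rep (angle a) = a + 2 * PI * IZR k.
Proof. apply angle_eq. now rewrite angle_rep. Qed.

Lemma sin_cos_2kPI (a : R) (k : Z) :
  sin (a + 2 * PI * IZR k) = sin a /\ cos (a + 2 * PI * IZR k) = cos a.
Proof.
assert (P : forall b n, sin (b + 2 * PI * INR n) = sin b /\
                        cos (b + 2 * PI * INR n) = cos b).
{ intros b n. replace (2 * PI * INR n) with (2 * INR n * PI) by ring.
  now rewrite sin_period, cos_period. }
destruct (Z_le_dec 0 k) as [Hk | Hk].
- rewrite <- (Z2Nat.id k Hk), <- INR_IZR_INZ. apply P.
- destruct (P (a + 2 * PI * IZR k) (Z.to_nat (- k))) as [P1 P2].
  rewrite INR_IZR_INZ, Z2Nat.id, opp_IZR in P1, P2 by lia.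
  replace (a + 2 * PI * IZR k + 2 * PI * - IZR k) with a in P1, P2 by ring.
  now split.
Qed.

Lemma sinS_angle (a : R) : sinS (angle a) = sin a.
Proof. unfold sinS. destruct (rep_angle a) as [k ->]. apply sin_cos_2kPI. Qed.

Lemma cosS_angle (a : R) : cosS (angle a) = cos a.
Proof. unfold cosS. destruct (rep_angle a) as [k ->]. apply sin_cos_2kPI. Qed.

(* The sign convention is omega (X_H, .) = - d(hamiltonian). *)
Lemma X_H_hamiltonian (p a : R) (v : tangent) :
  is_derive (fun s => hamiltonian (p + s * fst v, angle (a + s * snd v))) 0
    (- omega (p, angle a) (X_H (p, angle a)) v).
Proof.
apply is_derive_ext with
  (fun s => / 2 * (p + s * fst v) ^ 2 - cos (a + s * snd v) + 1).
- intros s. unfold hamiltonian; simpl. now rewrite cosS_angle.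
- unfold omega, X_H; simpl. rewrite sinS_angle.
  auto_derive; [easy |]. rewrite !Rmult_0_l, !Rplus_0_r. field.
Qed.

Lemma is_derive_on_eps {V : NormedModule R_AbsRing} (a b : R) (f : R -> V) (t : R) (l : V) :
  a <= t <= b -> is_derive_on a b f t l ->
  forall eps : posreal,
    locally t (fun s => a <= s <= b ->
      norm (minus (minus (f s) (f t)) (scal (s - t) l)) <= eps * Rabs (s - t)).
Proof.
intros Ht [_ D] eps.
assert (Fl : is_filter_lim (within (fun s => a <= s <= b) (locally t)) t).
{ intros Q HQ. unfold within. revert HQ. apply filter_imp. intros s Hs _; exact Hs. }
exact (D t Fl eps).
Qed.

Lemma is_derive_on_unique (a b : R) (f g : R -> R) (t l m : R) :
  a < b -> a <= t <= b ->
  is_derive_on a b f t l -> is_derive_on a b g t m ->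
  locally t (fun s => a <= s <= b -> f s - f t = g s - g t) -> l = m.
Proof.
intros Hab Ht Df Dg E.
destruct (Req_dec l m) as [| N]; [easy | exfalso].
assert (P : 0 < Rabs (l - m) / 4) by (assert (0 < Rabs (l - m)) by (apply Rabs_pos_lt; lra); lra).
pose (eps := mkposreal _ P).
pose proof (is_derive_on_eps a b f t l Ht Df eps) as Ef.
pose proof (is_derive_on_eps a b g t m Ht Dg eps) as Eg.
destruct (filter_and _ _ E (filter_and _ _ Ef Eg)) as [d Hd].
assert (Hs : exists s, a <= s <= b /\ s <> t /\ Rabs (s - t) < d).
{ pose proof (cond_pos d).
  destruct (Rlt_dec t b) as [L1 | L1].
  - exists (t + Rmin (d / 2) (b - t)).
    assert (0 < Rmin (d / 2) (b - t)) by (apply Rmin_pos; lra).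
    pose proof (Rmin_l (d / 2) (b - t)). pose proof (Rmin_r (d / 2) (b - t)).
    repeat split; try lra. rewrite Rabs_pos_eq; lra.
  - exists (t - Rmin (d / 2) (t - a)).
    assert (0 < Rmin (d / 2) (t - a)) by (apply Rmin_pos; lra).
    pose proof (Rmin_l (d / 2) (t - a)). pose proof (Rmin_r (d / 2) (t - a)).
    repeat split; try lra. rewrite Rabs_left; lra. }
destruct Hs as [s [Is [Ns Bs]]].
destruct (Hd s Bs) as [E1 [E2 E3]].
specialize (E1 Is); specialize (E2 Is); specialize (E3 Is).
unfold norm, minus, plus, opp, scal in E2, E3; simpl in E2, E3.
unfold abs, mult in E2, E3; simpl in E2, E3.
assert (B : Rabs ((s - t) * (l - m)) <= Rabs (l - m) / 2 * Rabs (s - t)).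
{ replace ((s - t) * (l - m)) with
    ((g s + - g t + - ((s - t) * m)) - (f s + - f t + - ((s - t) * l))) by lra.
  eapply Rle_trans; [apply Rabs_triang |]. rewrite Rabs_Ropp. lra. }
rewrite Rabs_mult in B.
assert (0 < Rabs (s - t)) by (apply Rabs_pos_lt; lra).
assert (0 < Rabs (l - m)) by (apply Rabs_pos_lt; lra).
nra.
Qed.

Lemma is_derive_on_near (a b : R) (f : R -> R) (t l : R) (eps : posreal) :
  a <= t <= b -> is_derive_on a b f t l ->
  locally t (fun s => a <= s <= b -> Rabs (f s - f t) < eps).
Proof.
intros Ht D.
pose proof (is_derive_on_eps a b f t l Ht D (mkposreal 1 Rlt_0_1)) as E.
assert (P : 0 < eps / (2 + Rabs l)).
{ apply Rdiv_lt_0_compat; [apply cond_pos | pose proof (Rabs_pos l); lra]. }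
assert (Q : locally t (fun s => Rabs (s - t) < eps / (2 + Rabs l))).
{ exists (mkposreal _ P). intros s Hs; exact Hs. }
generalize (filter_and _ _ E Q). apply filter_imp. intros s [E1 E2] Is.
specialize (E1 Is).
unfold norm, minus, plus, opp, scal in E1; simpl in E1.
unfold abs, mult in E1; simpl in E1.
pose proof (Rabs_pos l). pose proof (Rabs_pos (s - t)).
assert (B : Rabs (f s - f t) <= (1 + Rabs l) * Rabs (s - t)).
{ replace (f s - f t) with ((f s + - f t + - ((s - t) * l)) + (s - t) * l) by ring.
  eapply Rle_trans; [apply Rabs_triang |]. rewrite Rabs_mult. lra. }
apply Rmult_lt_compat_r with (r := 2 + Rabs l) in E2; [| lra].
unfold Rdiv in E2. rewrite Rmult_assoc, Rinv_l, Rmult_1_r in E2 by lra. nra.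
Qed.

Lemma has_velocity_unique (a b : R) (sigma : R -> TS1) (t : R) (v w : tangent) :
  a < b -> a <= t <= b ->
  has_velocity a b sigma t v -> has_velocity a b sigma t w -> v = w.
Proof.
intros Hab Ht [D1 [f [Ff Df]]] [D2 [g [Fg Dg]]].
rewrite (surjective_pairing v), (surjective_pairing w). f_equal.
- apply (is_derive_on_unique a b _ _ t _ _ Hab Ht D1 D2).
  apply filter_forall. now intros s _.
- apply (is_derive_on_unique a b f g t _ _ Hab Ht Df Dg).
  pose (one := mkposreal 1 Rlt_0_1).
  pose proof (is_derive_on_near a b f t _ one Ht Df) as Nf.
  pose proof (is_derive_on_near a b g t _ one Ht Dg) as Ng.
  unfold within in Ff, Fg.
  assert (E : locally t (fun s => a <= s <= b -> angle (f s) = angle (g s))).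
  { generalize (filter_and _ _ Ff Fg). apply filter_imp.
    intros s [E1 E2] Is. now rewrite <- E1, <- E2. }
  pose proof (locally_singleton _ _ E Ht) as E0.
  apply angle_eq in E0. destruct E0 as [k0 K0].
  generalize (filter_and _ _ E (filter_and _ _ Nf Ng)). apply filter_imp.
  intros s [E1 [E2 E3]] Is.
  specialize (E1 Is); specialize (E2 Is); specialize (E3 Is).
  apply angle_eq in E1. destruct E1 as [k K]. simpl in E2, E3.
  apply Rabs_def2 in E2, E3.
  pose proof PI2_3_2 as HP. unfold PI2 in HP.
  assert (Z1 : k = k0).
  { assert (IZR k - IZR k0 < 1) by nra.
    assert (-1 < IZR k - IZR k0) by nra.
    rewrite <- minus_IZR in *.
    assert (k - k0 < 1)%Z by (apply lt_IZR; lra).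
    assert (-1 < k - k0)%Z by (apply lt_IZR; lra).
    lia. }
  subst k0. lra.
Qed.

Lemma velocity_eq (a b : R) (sigma : R -> TS1) (t : R) (v : tangent) :
  a < b -> a <= t <= b -> has_velocity a b sigma t v -> velocity a b sigma t = v.
Proof.
intros Hab Ht Hv. apply (has_velocity_unique a b sigma t); try easy.
unfold velocity. apply epsilon_spec. now exists v.
Qed.

(* Main.v *)
Require Import Defs.
From Stdlib Require Import Reals Lra ZArith.
From Stdlib Require Import Classical ClassicalEpsilon FunctionalExtensionality.
From Coquelicot Require Import Coquelicot.
Open Scope R_scope.

(* Let F be the primitive of gamma^* theta vanishing at 0, so that
   F (T) = 2 pi I_gamma. Parallel transport once around gamma multiplies by
   exp (i F (T) / hbar), so trivial holonomy forces I_gamma to be an integer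
   multiple of hbar. Conversely, if it is one, then exp (i F / hbar), which is
   horizontal along gamma, takes equal values at 0 and T. By uniqueness of
   solutions and minimality of T, gamma has no other self-intersections, so this
   phase descends to a function on im gamma. It is then horizontal along every
   piecewise C^1 curve in im gamma, and a horizontal lift of a loop, being a
   constant multiple of it, closes up. To differentiate it along a curve in
   im gamma one needs that X_H does not vanish on im gamma and that gamma is
   proper onto its image; no parametrization of the curve by gamma has to be
   chosen differentiably. *)

(** * One-sided derivatives *)

Lemma plus_minus_minus {G : AbelianGroup} (u w : G) : minus (minus (plus u w) u) w = zero.
Proof.
unfold minus. rewrite (plus_comm u), <- (plus_assoc w), plus_opp_r, plus_zero_r.
apply plus_opp_r.
Qed.

(** [filterdiff] asks for the estimate at every limit point [x] of the restricted filter. As [t]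
    itself lies in [[a, b]], a limit point other than [t] would have neighbourhoods that miss [t],
    so [x = t]. *)
Lemma is_derive_on_of_eps {V : NormedModule R_AbsRing} (a b : R) (f : R -> V) (t : R) (l : V) :
  a <= t <= b ->
  (forall eps : posreal, locally t (fun s => a <= s <= b ->
     norm (minus (minus (f s) (f t)) (scal (s - t) l)) <= eps * Rabs (s - t))) ->
  is_derive_on a b f t l.
Proof.
intros Ht H. split; [exact (is_linear_scal_l (K := R_AbsRing) l) |]. intros x Hx eps.
assert (x = t) as ->; [| exact (H eps)].
destruct (Req_dec x t) as [| N]; [easy | exfalso].
assert (Q : 0 < Rabs (x - t)) by (apply Rabs_pos_lt; lra).
assert (B : locally x (fun s => Rabs (s - x) < Rabs (x - t))).
{ exists (mkposreal _ Q). intros s Hs; exact Hs. }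
apply Hx, locally_singleton in B. specialize (B Ht).
rewrite Rabs_minus_sym in B. lra.
Qed.

(** Continuing [f] outside [[a, b]] by its tangent line at [t], where the error term is exactly
    zero, turns the one-sided derivative into an ordinary one. The rules of calculus below are
    transferred from [is_derive] through this equivalence. *)
Lemma is_derive_on_iff_local_extension {V : NormedModule R_AbsRing} (a b : R)
    (f : R -> V) (t : R) (l : V) :
  a <= t <= b ->
  is_derive_on a b f t l <->
  exists g : R -> V, is_derive g t l /\ locally t (fun s => a <= s <= b -> g s = f s).
Proof.
intros Ht. split.
- intros D.
  exists (fun s => match excluded_middle_informative (a <= s <= b) with
    | left _ => f s | right _ => plus (f t) (scal (s - t) l) end).
  split.
  + split; [apply is_linear_scal_l |]. intros x Hx eps.
    apply (@is_filter_lim_locally_unique R_AbsRing R_NormedModule) in Hx. subst x.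
    generalize (is_derive_on_eps a b f t l Ht D eps). apply filter_imp. intros s Hs.
    destruct (excluded_middle_informative (a <= t <= b)) as [_ | N]; [| easy].
    destruct (excluded_middle_informative (a <= s <= b)) as [I | N].
    * exact (Hs I).
    * replace (minus _ _) with (@zero V).
      -- rewrite norm_zero. apply Rmult_le_pos; [apply Rlt_le, cond_pos | apply norm_ge_0].
      -- symmetry. exact (plus_minus_minus (f t) (scal (s - t) l)).
  + apply filter_forall. intros s Hs.
    destruct (excluded_middle_informative (a <= s <= b)); easy.
- intros [g [[_ Dg] E]]. apply is_derive_on_of_eps; [easy |]. intros eps.
  assert (L : is_filter_lim (locally t) t) by (intros P HP; exact HP).
  pose proof (locally_singleton _ _ E Ht) as E0.
  generalize (filter_and _ _ E (Dg t L eps)). apply filter_imp.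
  intros s [E1 E2] I. rewrite <- (E1 I), <- E0. exact E2.
Qed.

Lemma is_derive_is_derive_on {V : NormedModule R_AbsRing} (a b : R) (f : R -> V) (t : R) (l : V) :
  a <= t <= b -> is_derive f t l -> is_derive_on a b f t l.
Proof.
intros Ht D. apply is_derive_on_iff_local_extension; [easy |]. exists f. split; [easy |].
now apply filter_forall.
Qed.

Lemma is_derive_on_ext_loc {V : NormedModule R_AbsRing} (a b : R) (f g : R -> V) (t : R) (l : V) :
  a <= t <= b -> locally t (fun s => a <= s <= b -> f s = g s) ->
  is_derive_on a b f t l -> is_derive_on a b g t l.
Proof.
intros Ht E D. apply is_derive_on_iff_local_extension in D; [| easy].
destruct D as [h [D H]]. apply is_derive_on_iff_local_extension; [easy |].
exists h; split; [easy |]. generalize (filter_and _ _ E H). apply filter_imp.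
intros s [E1 E2] I. now rewrite E2, E1.
Qed.

Lemma is_derive_on_ext {V : NormedModule R_AbsRing} (a b : R) (f g : R -> V) (t : R) (l : V) :
  a <= t <= b -> (forall s, a <= s <= b -> f s = g s) ->
  is_derive_on a b f t l -> is_derive_on a b g t l.
Proof. intros Ht E. apply is_derive_on_ext_loc; [easy |]. now apply filter_forall. Qed.

Lemma is_derive_on_comp (a b : R) (f h : R -> R) (t l m : R) :
  a <= t <= b -> is_derive_on a b h t l -> is_derive f (h t) m ->
  is_derive_on a b (fun s => f (h s)) t (l * m).
Proof.
intros Ht D Df. apply is_derive_on_iff_local_extension in D; [| easy].
destruct D as [g [D H]]. apply is_derive_on_iff_local_extension; [easy |].
pose proof (locally_singleton _ _ H Ht) as E0.
exists (fun s => f (g s)); split.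
- apply (is_derive_comp f g t m l); [now rewrite E0 | easy].
- revert H. apply filter_imp. intros s E I. now rewrite E.
Qed.

Lemma is_derive_on_minus (a b : R) (f g : R -> R) (t l m : R) :
  a <= t <= b -> is_derive_on a b f t l -> is_derive_on a b g t m ->
  is_derive_on a b (fun s => f s - g s) t (l - m).
Proof.
intros Ht Df Dg. apply is_derive_on_iff_local_extension in Df, Dg; try easy.
destruct Df as [u [Du Hu]], Dg as [v [Dv Hv]].
apply is_derive_on_iff_local_extension; [easy |].
exists (fun s => u s - v s). split.
- now apply (is_derive_minus u v).
- generalize (filter_and _ _ Hu Hv). apply filter_imp. intros s [E1 E2] I.
  now rewrite E1, E2.
Qed.

Lemma is_derive_on_plus (a b : R) (f g : R -> R) (t l m : R) :
  a <= t <= b -> is_derive_on a b f t l -> is_derive_on a b g t m ->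
  is_derive_on a b (fun s => f s + g s) t (l + m).
Proof.
intros Ht Df Dg. apply is_derive_on_iff_local_extension in Df, Dg; try easy.
destruct Df as [u [Du Hu]], Dg as [v [Dv Hv]].
apply is_derive_on_iff_local_extension; [easy |].
exists (fun s => u s + v s). split.
- now apply (is_derive_plus u v).
- generalize (filter_and _ _ Hu Hv). apply filter_imp. intros s [E1 E2] I.
  now rewrite E1, E2.
Qed.

Lemma is_derive_on_mult (a b : R) (f g : R -> R) (t l m : R) :
  a <= t <= b -> is_derive_on a b f t l -> is_derive_on a b g t m ->
  is_derive_on a b (fun s => f s * g s) t (l * g t + f t * m).
Proof.
intros Ht Df Dg. apply is_derive_on_iff_local_extension in Df, Dg; try easy.
destruct Df as [u [Du Hu]], Dg as [v [Dv Hv]].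
apply is_derive_on_iff_local_extension; [easy |].
rewrite <- (locally_singleton _ _ Hu Ht), <- (locally_singleton _ _ Hv Ht).
exists (fun s => u s * v s). split.
- apply (is_derive_mult u v); [easy | easy |]. intros; apply Rmult_comm.
- generalize (filter_and _ _ Hu Hv). apply filter_imp. intros s [E1 E2] I.
  now rewrite E1, E2.
Qed.

Lemma is_derive_on_pair (a b : R) (z : R -> C) (t : R) (d : C) :
  is_derive_on (V := C_R_NormedModule) a b z t d <->
  is_derive_on a b (fun s => fst (z s)) t (fst d) /\
  is_derive_on a b (fun s => snd (z s)) t (snd d).
Proof.
unfold is_derive_on. split.
- intros D. split.
  + eapply filterdiff_ext_lin.
    * apply (filterdiff_comp z (fun w : C_R_NormedModule => fst w)
        (fun h => scal h d) (fun w : C_R_NormedModule => fst w) D).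
      apply (filterdiff_linear (fun w : C_R_NormedModule => fst w)).
      apply is_linear_fst.
    * easy.
  + eapply filterdiff_ext_lin.
    * apply (filterdiff_comp z (fun w : C_R_NormedModule => snd w)
        (fun h => scal h d) (fun w : C_R_NormedModule => snd w) D).
      apply (filterdiff_linear (fun w : C_R_NormedModule => snd w)).
      apply is_linear_snd.
    * easy.
- intros [D1 D2].
  apply filterdiff_ext with (fun s => (fst (z s), snd (z s))).
  { intros s. now destruct (z s). }
  eapply filterdiff_ext_lin.
  + apply (filterdiff_comp_2 (fun s => fst (z s)) (fun s => snd (z s))
      (fun u v : R => (u, v) : C_R_NormedModule) _ _ (fun u v : R => (u, v) : C_R_NormedModule)
      D1 D2).
    apply (filterdiff_ext (fun w : C_R_NormedModule => w)).
    { intros w. now destruct w. }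
    eapply filterdiff_ext_lin.
    * apply (filterdiff_linear (fun w : C_R_NormedModule => w)). apply is_linear_id.
    * intros w. now destruct w.
  + intros h. now destruct d.
Qed.

(** The retraction of the line onto [[a, b]]. Composing with it extends a function continuously past
    the end points, as the mean value theorem and integration with a variable bound require. *)
Definition clamp (a b t : R) : R := Rmax a (Rmin t b).

Lemma clamp_in (a b t : R) : a <= b -> a <= clamp a b t <= b.
Proof. intros. unfold clamp, Rmax, Rmin. repeat destruct Rle_dec; lra. Qed.

Lemma clamp_id (a b t : R) : a <= t <= b -> clamp a b t = t.
Proof. intros. unfold clamp, Rmax, Rmin. repeat destruct Rle_dec; lra. Qed.

Lemma clamp_lipschitz (a b s t : R) : Rabs (clamp a b s - clamp a b t) <= Rabs (s - t).
Proof. unfold clamp, Rmax, Rmin, Rabs. repeat destruct Rle_dec; repeat destruct Rcase_abs; lra. Qed.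

Lemma is_derive_on_continuous_clamp (a b : R) (f df : R -> R) :
  a <= b -> (forall t, a <= t <= b -> is_derive_on a b f t (df t)) ->
  forall t, continuous (fun s => f (clamp a b s)) t.
Proof.
intros Hab D t. apply filterlim_locally. intros eps.
pose proof (clamp_in a b t Hab) as I.
destruct (is_derive_on_near a b f _ _ eps I (D _ I)) as [d Hd].
exists d. intros s Hs. apply Hd; [| now apply clamp_in].
eapply Rle_lt_trans; [apply clamp_lipschitz | exact Hs].
Qed.

Lemma is_derive_on_interior (a b : R) (f : R -> R) (t l : R) :
  a < t < b -> is_derive_on a b f t l -> is_derive f t l.
Proof.
intros Ht D. apply is_derive_on_iff_local_extension in D; [| lra].
destruct D as [g [D H]]. apply is_derive_ext_loc with g; [| easy].
assert (O : locally t (fun s => a < s < b)).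
{ apply (open_and _ _ (open_gt a) (open_lt b)). exact Ht. }
generalize (filter_and _ _ H O). apply filter_imp. intros s [E I]. apply E; lra.
Qed.

(** The mean value theorem for [f] composed with [clamp]: this is continuous on both sides of the
    end points, and inside the interval it has the derivative of [f]. *)
Lemma is_derive_on_zero_constant (a b : R) (f : R -> R) :
  (forall t, a <= t <= b -> is_derive_on a b f t 0) ->
  forall t, a <= t <= b -> f t = f a.
Proof.
intros D t Ht.
destruct (MVT_gen (fun s => f (clamp a b s)) a t (fun _ => 0)) as [c [_ E]].
- rewrite Rmin_left, Rmax_right by lra. intros x Hx.
  apply is_derive_ext_loc with f.
  + assert (O : locally x (fun s => a < s < b)).
    { apply (open_and _ _ (open_gt a) (open_lt b)). lra. }
    revert O. apply filter_imp. intros s I. now rewrite clamp_id by lra.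
  + apply (is_derive_on_interior a b); [lra | apply D; lra].
- intros x _. apply continuity_pt_filterlim.
  apply (is_derive_on_continuous_clamp a b f (fun _ => 0)); [lra | easy].
- rewrite !clamp_id in E by lra. lra.
Qed.

(** * Lifting integral curves to the universal cover *)

Lemma cos_eq_1 (x : R) : cos x = 1 -> exists k : Z, x = 2 * PI * IZR k.
Proof.
intros E. replace x with (2 * (x / 2)) in E by field. rewrite cos_2a_sin in E.
destruct (sin_eq_0_0 (x / 2)) as [k K]; [nra |].
exists k. lra.
Qed.

(** This replaces equality in the quotient by a real equation that can be differentiated and that
    involves no choice of an integer. *)
Lemma cos_minus_eq_1 (x y : R) : cos (x - y) = 1 <-> angle x = angle y.
Proof.
rewrite angle_eq. split.
- intros E. apply cos_eq_1 in E. destruct E as [k E]. exists (- k)%Z. rewrite opp_IZR. lra.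
- intros [k ->]. replace (x - (x + 2 * PI * IZR k)) with (0 + 2 * PI * IZR (- k))
    by (rewrite opp_IZR; ring).
  destruct (sin_cos_2kPI 0 (- k)) as [_ ->]. apply cos_0.
Qed.

(* [p] and [a] are the coordinates of a curve in the universal cover, and [F] is
   a primitive of the pullback of [theta] along it. *)
Definition pendulum_lift (gamma : R -> TS1) (T : R) (p a F : R -> R) : Prop :=
  forall t, 0 <= t <= T ->
    gamma t = (p t, angle (a t)) /\
    is_derive p t (- sin (a t)) /\ is_derive a t (p t) /\ is_derive F t (p t * p t).

Lemma Derive_eq (f : R -> R) (t l : R) : is_derive f t l -> Derive (fun s : R => f s) t = l.
Proof. exact (is_derive_unique f t l). Qed.

Lemma is_derive_primitive (f : R -> R) (c : R) :
  (forall t, continuous f t) -> forall t, is_derive (fun s => c + RInt f 0 s) t (f t).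
Proof.
intros H t.
assert (D : is_derive (fun s => RInt f 0 s) t (f t)).
{ apply (is_derive_RInt f (RInt f 0) 0 t); [| apply H].
  apply filter_forall. intros s. apply (RInt_correct f 0 s).
  apply (ex_RInt_continuous f). intros; apply H. }
evar (l : R). replace (f t) with l; [apply (is_derive_plus (fun _ => c) _ t) | ].
- apply is_derive_const.
- exact D.
- unfold l. apply plus_zero_l.
Qed.

(** The differentiated function is locally [cos (lift s - f s)]. Writing it through [cosS] and
    [sinS] makes it a single function on all of [[a, b]], although [lift] represents the angle only
    near [t]. *)
Lemma is_derive_on_angle_defect (a b t l m : R) (sigma : R -> TS1) (lift f : R -> R) :
  a <= t <= b ->
  within (fun s => a <= s <= b) (locally t) (fun s => snd (sigma s) = angle (lift s)) ->
  is_derive_on a b lift t l -> is_derive_on a b f t m ->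
  is_derive_on a b (fun s => cosS (snd (sigma s)) * cos (f s) + sinS (snd (sigma s)) * sin (f s))
    t (- sin (lift t - f t) * (l - m)).
Proof.
intros Ht E Dl Df.
apply is_derive_on_ext_loc with (fun s => cos (lift s - f s)); [easy | |].
- unfold within in E. revert E. apply filter_imp. intros s E I. rewrite (E I), cosS_angle, sinS_angle.
  apply cos_minus.
- rewrite Rmult_comm.
  apply (is_derive_on_comp a b cos (fun s => lift s - f s)); [easy | |].
  + now apply is_derive_on_minus.
  + apply is_derive_Reals, derivable_pt_lim_cos.
Qed.

(** Instead of patching local lifts together, the lift is built by integration and then shown to
    project to [gamma]. Since [theta (X_H)] is the squared momentum, integrating that square gives
    [F]. *)
Lemma integral_curve_lift (gamma : R -> TS1) (T : R) :
  0 < T -> integral_curve X_H gamma 0 T ->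
  exists p a F : R -> R, pendulum_lift gamma T p a F /\
    F 0 = 0 /\ F T = 2 * PI * action gamma T.
Proof.
intros HT Hg.
(* Clamping makes the momentum continuous on the whole line, so its integral [a] has a two-sided
   derivative even at [0] and [T]. *)
pose (P := fun t => fst (gamma (clamp 0 T t))).
assert (CP : forall t, continuous P t).
{ apply (is_derive_on_continuous_clamp 0 T (fun s => fst (gamma s))
    (fun s => - sinS (snd (gamma s)))); [lra |].
  intros t Ht. apply (Hg t Ht). }
assert (EP : forall t, 0 <= t <= T -> P t = fst (gamma t)).
{ intros t Ht. unfold P. now rewrite clamp_id. }
pose (a := fun t => rep (snd (gamma 0)) + RInt P 0 t).
assert (Da : forall t, is_derive a t (P t)) by now apply is_derive_primitive.
assert (Ea : forall t, 0 <= t <= T -> snd (gamma t) = angle (a t)).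
(* [u] is the cosine of the angle between [gamma] and the candidate lift [a]. Both rotate at rate
   [P], so [u] keeps its initial value [1]. *)
{ pose (u := fun s => cosS (snd (gamma s)) * cos (a s) + sinS (snd (gamma s)) * sin (a s)).
  assert (U : forall t, 0 <= t <= T -> u t = u 0).
  { apply is_derive_on_zero_constant. intros t Ht.
    destruct (Hg t Ht) as [_ [lift [El Dl]]].
    replace 0 with (- sin (lift t - a t) * (snd (X_H (gamma t)) - P t)) at 2.
    - apply is_derive_on_angle_defect; try easy. now apply is_derive_is_derive_on.
    - rewrite EP by easy. simpl. ring. }
  intros t Ht. specialize (U t Ht).
  assert (E0 : u 0 = 1).
  { unfold u, a, cosS, sinS. rewrite RInt_point, <- cos_minus.
    replace (_ - _) with 0 by (unfold zero; simpl; ring). apply cos_0. }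
  rewrite E0 in U. unfold u in U. rewrite <- (angle_rep (snd (gamma t))).
  apply cos_minus_eq_1. rewrite cos_minus. exact U. }
(* The clamped momentum [P] is constant beyond the end points and has in general only one-sided
   derivatives there. Integrating [- sin (a s)] gives a momentum that agrees with it on [[0, T]] and
   is differentiable on both sides. *)
pose (p := fun t => fst (gamma 0) + RInt (fun s => - sin (a s)) 0 t).
assert (Dp : forall t, is_derive p t (- sin (a t))).
{ apply (is_derive_primitive (fun s => - sin (a s))). intros t.
  apply (ex_derive_continuous (fun s => - sin (a s))). exists (- (P t * cos (a t))).
  auto_derive; [now exists (P t) | rewrite (Derive_eq a t (P t) (Da t)); ring]. }
assert (Ep : forall t, 0 <= t <= T -> fst (gamma t) = p t).
{ intros t Ht.
  assert (E : fst (gamma t) - p t = fst (gamma 0) - p 0).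
  { revert t Ht. apply (is_derive_on_zero_constant 0 T (fun t => fst (gamma t) - p t)).
    intros t Ht. destruct (Hg t Ht) as [D _].
    replace 0 with (fst (X_H (gamma t)) - - sin (a t)) at 2.
    - apply is_derive_on_minus; [easy | easy | now apply is_derive_is_derive_on].
    - simpl. rewrite Ea, sinS_angle by easy. ring. }
  assert (E0 : p 0 = fst (gamma 0)).
  { unfold p. rewrite RInt_point. apply Rplus_0_r. }
  lra. }
exists p, a, (fun t => 0 + RInt (fun s => P s * P s) 0 t).
split; [intros t Ht; split; [| split; [| split]] | split].
- rewrite (surjective_pairing (gamma t)). now rewrite Ep, Ea.
- apply Dp.
- rewrite <- Ep, <- EP by easy. apply Da.
- rewrite <- Ep, <- EP by easy. apply (is_derive_primitive (fun s => P s * P s)).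
  intros s. apply (continuous_mult P P); apply CP.
- rewrite RInt_point. unfold zero; simpl; ring.
- unfold action. rewrite Rplus_0_l, <- Rmult_assoc, Rinv_r, Rmult_1_l
    by (pose proof PI_neq0; lra).
  apply RInt_ext. intros s Hs. rewrite Rmin_left, Rmax_right in Hs by lra.
  unfold pullback, theta. rewrite (velocity_eq 0 T gamma s (X_H (gamma s))) by (lra || apply Hg; lra).
  simpl. rewrite EP by lra. easy.
Qed.

(** * Uniqueness of solutions of the pendulum equation *)

Lemma sin_lipschitz (x y : R) : Rabs (sin x - sin y) <= Rabs (x - y).
Proof.
destruct (MVT_gen sin y x cos) as [c [_ ->]].
- intros; apply is_derive_Reals, derivable_pt_lim_sin.
- intros; apply continuity_sin.
- rewrite Rabs_mult. pose proof (Rabs_pos (x - y)).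
  assert (Rabs (cos c) <= 1) by (apply Rabs_le, COS_bound). nra.
Qed.

(** Grönwall's argument: [D t * exp (- 2 * t)] is nonincreasing, nonnegative and zero at [u]. *)
Lemma vanishing_forward (D dD : R -> R) (u v : R) :
  u <= v -> (forall t, u <= t <= v -> 0 <= D t /\ is_derive D t (dD t) /\ dD t <= 2 * D t) ->
  D u = 0 -> D v = 0.
Proof.
intros Huv H E.
destruct (MVT_gen (fun t => D t * exp (- 2 * t)) u v
  (fun t => (dD t - 2 * D t) * exp (- 2 * t))) as [c [Hc M]].
- rewrite Rmin_left, Rmax_right by lra. intros t Ht.
  destruct (H t) as [_ [Dt _]]; [lra |].
  auto_derive; [now exists (dD t) | rewrite (Derive_eq D t (dD t) Dt); ring].
- rewrite Rmin_left, Rmax_right by lra. intros t Ht.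
  destruct (H t) as [_ [Dt _]]; [lra |]. apply continuity_pt_filterlim.
  apply (ex_derive_continuous (fun t => D t * exp (- 2 * t))).
  auto_derive. now exists (dD t).
- rewrite Rmin_left, Rmax_right in Hc by lra. destruct (H c Hc) as [_ [_ L]].
  destruct (H v) as [P _]; [lra |].
  pose proof (exp_pos (- 2 * c)). pose proof (exp_pos (- 2 * v)). rewrite E in M.
  assert (0 <= (2 * D c - dD c) * exp (-2 * c)) by (apply Rmult_le_pos; lra).
  assert (D v * exp (-2 * v) <= 0) by nra. nra.
Qed.

Lemma vanishing (D dD : R -> R) (u v s t : R) :
  (forall t, u <= t <= v -> 0 <= D t /\ is_derive D t (dD t) /\ Rabs (dD t) <= 2 * D t) ->
  u <= s <= v -> u <= t <= v -> D s = 0 -> D t = 0.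
Proof.
intros H Hs Ht E. destruct (Rle_dec s t) as [L | L].
- apply (vanishing_forward D dD s t L); [| easy]. intros r Hr.
  destruct (H r) as [A [B C]]; [lra |]. apply Rabs_le_between in C.
  split; [easy | split; [easy | lra]].
- replace t with (- - t) by ring.
  apply (vanishing_forward (fun r => D (- r)) (fun r => - dD (- r)) (- s) (- t)).
  + lra.
  + intros r Hr. destruct (H (- r)) as [A [B C]]; [lra |]. apply Rabs_le_between in C.
    split; [easy | split; [| lra]].
    auto_derive; [now exists (dD (- r)) | rewrite (Derive_eq D (- r) (dD (- r)) B); ring].
  + now rewrite Ropp_involutive.
Qed.

(** The squared distance [D] of two solutions satisfies [Rabs D' <= 2 * D]: with [x] and [y] the
    distances in momentum and angle, the Lipschitz bound for sine gives at most [4 * x * y], hence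
    at most [2 * (x ^ 2 + y ^ 2)]. *)
Lemma pendulum_unique (p1 a1 p2 a2 : R -> R) (u v s t : R) :
  (forall t, u <= t <= v -> is_derive p1 t (- sin (a1 t)) /\ is_derive a1 t (p1 t)) ->
  (forall t, u <= t <= v -> is_derive p2 t (- sin (a2 t)) /\ is_derive a2 t (p2 t)) ->
  u <= s <= v -> u <= t <= v -> p1 s = p2 s -> a1 s = a2 s ->
  p1 t = p2 t /\ a1 t = a2 t.
Proof.
intros H1 H2 Hs Ht Ep Ea.
assert (D : (p1 t - p2 t) ^ 2 + (a1 t - a2 t) ^ 2 = 0).
{ apply (vanishing (fun t => (p1 t - p2 t) ^ 2 + (a1 t - a2 t) ^ 2)
    (fun t => 2 * (p1 t - p2 t) * (- (sin (a1 t) - sin (a2 t))) +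
      2 * (a1 t - a2 t) * (p1 t - p2 t)) u v s t); try easy.
  - intros r Hr. destruct (H1 r Hr) as [P1 A1], (H2 r Hr) as [P2 A2]. split; [| split].
    + apply Rplus_le_le_0_compat; apply pow2_ge_0.
    + auto_derive; [repeat split; eexists; eassumption |].
      rewrite (Derive_eq p1 r _ P1), (Derive_eq p2 r _ P2),
        (Derive_eq a1 r _ A1), (Derive_eq a2 r _ A2). ring.
    + eapply Rle_trans; [apply Rabs_triang |].
      rewrite !Rabs_mult, Rabs_Ropp, (Rabs_pos_eq 2) by lra.
      pose proof (sin_lipschitz (a1 r) (a2 r)) as S.
      rewrite <- (pow2_abs (p1 r - p2 r)), <- (pow2_abs (a1 r - a2 r)).
      pose proof (Rabs_pos (p1 r - p2 r)). pose proof (Rabs_pos (a1 r - a2 r)).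
      set (x := Rabs (p1 r - p2 r)) in *. set (y := Rabs (a1 r - a2 r)) in *.
      set (z := Rabs (sin (a1 r) - sin (a2 r))) in *.
      assert (0 <= x * (y - z)) by (apply Rmult_le_pos; lra).
      pose proof (pow2_ge_0 (x - y)). nra.
  - rewrite Ep, Ea. ring. }
pose proof (pow2_ge_0 (p1 t - p2 t)). pose proof (pow2_ge_0 (a1 t - a2 t)).
split; apply Rminus_diag_uniq, Rsqr_0_uniq; unfold Rsqr; lra.
Qed.

(** * Differentiating functions on the image of a periodic curve *)

(** A coincidence at times [s < t] propagates by uniqueness to all times, so [t - s] is a period and
    minimality gives [T <= t - s]. *)
Lemma periodic_curve_injective (gamma : R -> TS1) (T : R) (p a F : R -> R) (s t : R) :
  periodic_integral_curve X_H gamma T -> pendulum_lift gamma T p a F ->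
  0 <= s -> s < t -> t <= T -> gamma s = gamma t -> s = 0 /\ t = T.
Proof.
intros [_ [_ [_ Hmin]]] HL Hs Hst Ht E.
assert (T <= t - s); [| lra]. apply Hmin. split; [lra |]. intros r Hr.
assert (Is : 0 <= s <= T) by lra. assert (It : 0 <= t <= T) by lra.
assert (Ir : 0 <= r <= T) by lra. assert (Irr : 0 <= r + (t - s) <= T) by lra.
destruct (HL _ Is) as [Gs _], (HL _ It) as [Gt _], (HL _ Ir) as [Gr _], (HL _ Irr) as [Grr _].
rewrite Gs, Gt in E. apply pair_equal_spec in E. destruct E as [Ep Ea].
apply angle_eq in Ea. destruct Ea as [k Ea].
(* The comparison solution is the lift shifted by [t - s] in time and by [- 2 * PI * IZR k] in
   angle. The equation is autonomous and [2 * PI]-periodic, so the shifted lift solves it as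
   well. *)
destruct (pendulum_unique p a (fun r => p (r + (t - s)))
  (fun r => a (r + (t - s)) - 2 * PI * IZR k) 0 (T - (t - s)) s r) as [U1 U2]; try lra.
- intros q Hq. destruct (HL q) as [_ [D1 [D2 _]]]; [lra |]. easy.
- intros q Hq. destruct (HL (q + (t - s))) as [_ [D1 [D2 _]]]; [lra |]. split.
  + replace (a (q + (t - s)) - 2 * PI * IZR k)
      with (a (q + (t - s)) + 2 * PI * IZR (- k)) by (rewrite opp_IZR; ring).
    rewrite (proj1 (sin_cos_2kPI _ _)).
    auto_derive; [eexists; exact D1 | rewrite (Derive_eq p _ _ D1); ring].
  + auto_derive; [eexists; exact D2 | rewrite (Derive_eq a _ _ D2); ring].
- now replace (s + (t - s)) with t by ring.
- replace (s + (t - s)) with t by ring. lra.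
- rewrite Gr, Grr, U1. f_equal. symmetry. apply angle_eq. exists k. lra.
Qed.

(** At a zero of [X_H] the constant curve is also a solution, so uniqueness would make [gamma]
    constant. *)
Lemma periodic_curve_regular (gamma : R -> TS1) (T : R) (p a F : R -> R) (s : R) :
  periodic_integral_curve X_H gamma T -> pendulum_lift gamma T p a F ->
  0 <= s <= T -> sin (a s) <> 0 \/ p s <> 0.
Proof.
intros [_ [[t [Ht N]] [[[HT _] _] _]]] HL Hs.
destruct (Req_dec (sin (a s)) 0) as [Es |]; [| now left].
destruct (Req_dec (p s) 0) as [Ep |]; [| now right]. exfalso. apply N.
assert (C : forall r, 0 <= r <= T -> gamma r = (p s, angle (a s))).
{ intros r Hr. destruct (HL r Hr) as [-> _].
  destruct (pendulum_unique p a (fun _ => p s) (fun _ => a s) 0 T s r) as [U1 U2]; try easy.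
  - intros q Hq. destruct (HL q Hq) as [_ [D1 [D2 _]]]. easy.
  - intros q Hq. rewrite Es, Ep, Ropp_0.
    split; [exact (is_derive_const _ q) | exact (is_derive_const _ q)].
  - now rewrite U1, U2. }
rewrite !C; lra || easy.
Qed.

(** * Local estimates and their uniformity on a compact interval *)

Lemma is_derive_eps (f : R -> R) (t l eps : R) :
  is_derive f t l -> 0 < eps ->
  locally t (fun s => Rabs (f s - f t - (s - t) * l) <= eps * Rabs (s - t)).
Proof.
intros [_ D] He. exact (D t (fun P H => H) (mkposreal eps He)).
Qed.

Lemma is_derive_expanding (f : R -> R) (t l : R) :
  is_derive f t l -> l <> 0 ->
  locally t (fun s => Rabs l / 2 * Rabs (s - t) <= Rabs (f s - f t)).
Proof.
intros D N. assert (P : 0 < Rabs l) by now apply Rabs_pos_lt.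
generalize (is_derive_eps f t l (Rabs l / 2) D ltac:(lra)). apply filter_imp.
intros s E. assert (A : Rabs ((s - t) * l) <= Rabs (f s - f t) + Rabs l / 2 * Rabs (s - t)).
{ replace ((s - t) * l) with ((f s - f t) + - (f s - f t - (s - t) * l)) by ring.
  eapply Rle_trans; [apply Rabs_triang | rewrite Rabs_Ropp; lra]. }
rewrite Rabs_mult in A. lra.
Qed.

(** Compactness of [[u, v]] turns radii depending on the centre [s] into one [d]. Monotonicity of
    [Q] in the radius allows passing from the radius at the centre to the smaller [d]. *)
Lemma finite_gauge (u v : R) (Q : posreal -> R -> R -> Prop) :
  (forall (d e : posreal) s t, e <= d -> Q d s t -> Q e s t) ->
  (forall s, u <= s <= v -> exists d : posreal, forall t, Rabs (t - s) < d -> Q d s t) ->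
  exists d : posreal, forall t, u <= t <= v -> exists s, u <= s <= v /\ Q d s t.
Proof.
intros M H.
assert (H' : forall s, exists d : posreal, u <= s <= v -> forall t, Rabs (t - s) < d -> Q d s t).
{ intros s. destruct (classic (u <= s <= v)) as [I | I].
  - destruct (H s I) as [d Hd]. now exists d.
  (* The gauge must be defined on the whole line; [1] is a dummy value outside the interval. *)
  - exists (mkposreal 1 Rlt_0_1). easy. }
pose (delta := fun s => proj1_sig (constructive_indefinite_description _ (H' s))).
destruct (compactness_value_1d u v delta) as [d Hd].
exists d. intros t Ht. specialize (Hd t Ht). apply NNPP in Hd.
destruct Hd as [s [Is [Ds Le]]]. exists s. split; [easy |].
apply (M (delta s)); [easy |].
exact (proj2_sig (constructive_indefinite_description _ (H' s)) Is t Ds).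
Qed.

Lemma is_derive_continuity_lt (f : R -> R) (t l c : R) :
  is_derive f t l -> c < f t -> locally t (fun s => c < f s).
Proof.
intros D Hc. assert (P : 0 < f t - c) by lra.
assert (C : continuous f t) by (apply (ex_derive_continuous f); now exists l).
generalize (proj1 (filterlim_locally f (f t)) C (mkposreal _ P)). apply filter_imp.
intros s B. apply Rabs_def2 in B. simpl in B. unfold minus, plus, opp in B; simpl in B. lra.
Qed.

(* [p s] and [a s] control the distance of [gamma s] to [gamma s0] in the
   cylinder. Compactness of [0, T] is what makes the estimate hold along
   sequences [gamma s] tending to [gamma s0] for which [s] does not tend to [s0]. *)
Lemma descent_estimate (gamma : R -> TS1) (T : R) (p a F : R -> R) (G : R -> R) (c s0 eps : R) :
  pendulum_lift gamma T p a F ->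
  (forall s, 0 <= s <= T -> sin (a s) <> 0 \/ p s <> 0) ->
  0 <= s0 <= T ->
  (forall s, 0 <= s <= T -> gamma s = gamma s0 -> G s = G s0 /\ is_derive G s (c * p s)) ->
  0 < eps ->
  exists d : posreal, forall s, 0 <= s <= T ->
    Rabs (p s - p s0) + (1 - cos (a s - a s0)) < d ->
    Rabs (G s - G s0 - c * sin (a s - a s0)) <=
      eps * (Rabs (p s - p s0) + Rabs (sin (a s - a s0))).
Proof.
intros HL Hreg Hs0 HG Heps.
destruct (finite_gauge 0 T (fun d _ s =>
  Rabs (p s - p s0) + (1 - cos (a s - a s0)) < d ->
  Rabs (G s - G s0 - c * sin (a s - a s0)) <=
    eps * (Rabs (p s - p s0) + Rabs (sin (a s - a s0))))) as [d Hd].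
- intros d e _ s Le H L. apply H. lra.
- intros s Hs. destruct (HL s Hs) as [Gs [Dp [Da _]]], (HL s0 Hs0) as [Gs0 _].
  (* Near a preimage [s] of the point [gamma s0], the error has derivative zero while the distance
     grows at least linearly. Near any other [s] the distance stays above some [m], and a radius
     below [m] makes the smallness hypothesis fail. *)
  destruct (classic (gamma s = gamma s0)) as [E | N].
  + destruct (HG s Hs E) as [EG DG].
    rewrite Gs, Gs0 in E. apply pair_equal_spec in E. destruct E as [Ep Ea].
    apply cos_minus_eq_1 in Ea.
    assert (Sa : sin (a s - a s0) = 0).
    { pose proof (sin2_cos2 (a s - a s0)) as S. rewrite Ea in S. apply Rsqr_0_uniq.
      unfold Rsqr in *. lra. }
    assert (DS : is_derive (fun r => sin (a r - a s0)) s (p s)).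
    { auto_derive; [eexists; exact Da |]. rewrite (Derive_eq a _ _ Da).
      change (a s + - a s0) with (a s - a s0). rewrite Ea. ring. }
    assert (Dpsi : is_derive (fun r => G r - G s0 - c * sin (a r - a s0)) s 0).
    { auto_derive; [split; [eexists; exact DG | split; [eexists; exact Da | easy]] |].
      rewrite (Derive_eq a _ _ Da), (Derive_eq G _ _ DG).
      change (a s + - a s0) with (a s - a s0). rewrite Ea. ring. }
    (* At [s] the derivatives of [p r] and of [sin (a r - a s0)] are the two components of [X_H].
       One of them is nonzero, and that one gives the linear lower bound. *)
    assert (Ex : exists m, 0 < m /\ locally s (fun r =>
      m * Rabs (r - s) <= Rabs (p r - p s0) + Rabs (sin (a r - a s0)))).
    { destruct (Hreg s Hs) as [N | N].
      - exists (Rabs (- sin (a s)) / 2). split.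
        + rewrite Rabs_Ropp. pose proof (Rabs_pos_lt _ N). lra.
        + assert (N' : - sin (a s) <> 0) by lra.
          generalize (is_derive_expanding p s _ Dp N'). apply filter_imp. intros r B.
          rewrite Ep in B. pose proof (Rabs_pos (sin (a r - a s0))). lra.
      - exists (Rabs (p s) / 2). split.
        + pose proof (Rabs_pos_lt _ N). lra.
        + generalize (is_derive_expanding _ s _ DS N). apply filter_imp. intros r B.
          rewrite Sa, Rminus_0_r in B. pose proof (Rabs_pos (p r - p s0)). lra. }
    destruct Ex as [m [Pm Lm]].
    pose proof (is_derive_eps _ s 0 (eps * m) Dpsi (Rmult_lt_0_compat _ _ Heps Pm)) as Ld.
    destruct (filter_and _ _ Lm Ld) as [d Hd]. exists d. intros r Hr _.
    destruct (Hd r Hr) as [B1 B2]. rewrite Sa, EG in B2.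
    replace (G r - G s0 - c * sin (a r - a s0)) with
      (G r - G s0 - c * sin (a r - a s0) - (G s0 - G s0 - c * 0) - (r - s) * 0) by ring.
    eapply Rle_trans; [exact B2 |]. rewrite Rmult_assoc. apply Rmult_le_compat_l; lra.
  + assert (Ex : exists m, 0 < m /\ locally s (fun r =>
      m < Rabs (p r - p s0) + (1 - cos (a r - a s0)))).
    { destruct (Req_dec (p s) (p s0)) as [Ep | Np].
      - assert (Nc : cos (a s - a s0) <> 1).
        { intros Ec. apply N. rewrite Gs, Gs0, Ep. apply cos_minus_eq_1 in Ec. now rewrite Ec. }
        pose proof (COS_bound (a s - a s0)).
        exists ((1 - cos (a s - a s0)) / 2). split; [lra |].
        assert (DC : is_derive (fun r => 1 - cos (a r - a s0)) s (p s * sin (a s - a s0))).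
        { auto_derive; [eexists; exact Da |]. rewrite (Derive_eq a _ _ Da).
          change (a s + - a s0) with (a s - a s0). ring. }
        generalize (is_derive_continuity_lt _ s _ ((1 - cos (a s - a s0)) / 2) DC ltac:(lra)).
        apply filter_imp. intros r B. pose proof (Rabs_pos (p r - p s0)). lra.
      - assert (P : 0 < (p s - p s0) ^ 2) by (apply pow2_gt_0; lra).
        assert (Pa : 0 < Rabs (p s - p s0)) by (apply Rabs_pos_lt; lra).
        exists (Rabs (p s - p s0) / 2). split; [lra |].
        (* Squaring makes the momentum distance differentiable; a quarter of the square corresponds
           to half of the distance. *)
        assert (DC : is_derive (fun r => (p r - p s0) ^ 2) s (- 2 * (p s - p s0) * sin (a s))).
        { auto_derive; [eexists; exact Dp |]. rewrite (Derive_eq p _ _ Dp). ring. }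
        generalize (is_derive_continuity_lt _ s _ ((p s - p s0) ^ 2 / 4) DC ltac:(lra)).
        apply filter_imp. intros r B. pose proof (COS_bound (a r - a s0)).
        rewrite <- (pow2_abs (p s - p s0)), <- (pow2_abs (p r - p s0)) in B.
        pose proof (Rabs_pos (p r - p s0)). nra. }
    destruct Ex as [m [Pm [d Hd]]].
    exists (mkposreal _ (Rmin_stable_in_posreal (mkposreal m Pm) d)). simpl. intros r Hr L.
    specialize (Hd r (Rlt_le_trans _ _ _ Hr (Rmin_r _ _))).
    pose proof (Rmin_l m d). simpl in *. lra.
- exists d. intros s Hs. now destruct (Hd s Hs) as [_ [_ H]].
Qed.

Lemma is_derive_on_lipschitz (a b : R) (f : R -> R) (t l : R) :
  a <= t <= b -> is_derive_on a b f t l ->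
  locally t (fun s => a <= s <= b -> Rabs (f s - f t) <= (Rabs l + 1) * Rabs (s - t)).
Proof.
intros Ht D. generalize (is_derive_on_eps a b f t l Ht D (mkposreal 1 Rlt_0_1)).
apply filter_imp. intros s E I. specialize (E I).
change (Rabs (f s - f t - (s - t) * l) <= 1 * Rabs (s - t)) in E.
replace (f s - f t) with ((f s - f t - (s - t) * l) + (s - t) * l) by ring.
eapply Rle_trans; [apply Rabs_triang |]. rewrite Rabs_mult. lra.
Qed.

Lemma sin_cos_minus_angle (x x' y y' : R) :
  angle x = angle x' -> angle y = angle y' ->
  sin (x - y) = sin (x' - y') /\ cos (x - y) = cos (x' - y').
Proof.
intros Ex Ey. rewrite !sin_minus, !cos_minus.
now rewrite <- !(sinS_angle x), <- !(cosS_angle x), Ex, <- !(sinS_angle y), <- !(cosS_angle y), Ey,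
  !sinS_angle, !cosS_angle.
Qed.

(** A chain rule in which [c] is the derivative of [g] with respect to the angle. Each [sigma r] is
    written as some [gamma s]; then [sin (a s - a s0)] equals [sin (lift r - lift t)], whose
    derivative at [t] is [snd w], and [descent_estimate] controls the rest. *)
Lemma is_derive_on_descent (gamma : R -> TS1) (T : R) (p a F : R -> R) (g : TS1 -> R)
    (G : R -> R) (c s0 u v : R) (sigma : R -> TS1) (t : R) (w : tangent) :
  pendulum_lift gamma T p a F ->
  (forall s, 0 <= s <= T -> sin (a s) <> 0 \/ p s <> 0) ->
  0 <= s0 <= T ->
  (forall s, 0 <= s <= T -> g (gamma s) = G s) ->
  (forall s, 0 <= s <= T -> gamma s = gamma s0 -> is_derive G s (c * p s)) ->
  u <= t <= v -> (forall r, u <= r <= v -> im gamma T (sigma r)) -> sigma t = gamma s0 ->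
  has_velocity u v sigma t w ->
  is_derive_on u v (fun r => g (sigma r)) t (c * snd w).
Proof.
intros HL Hreg Hs0 Hg HG Ht Him Et [Dp [lift [El Dl]]].
assert (Dm : is_derive_on u v (fun r => lift r - lift t) t (snd w)).
{ rewrite <- (Rminus_0_r (snd w)). apply is_derive_on_minus; [easy | easy |].
  apply is_derive_is_derive_on; [easy |]. exact (is_derive_const _ t). }
assert (DS : is_derive_on u v (fun r => sin (lift r - lift t)) t (snd w)).
{ rewrite <- (Rmult_1_r (snd w)), <- cos_0.
  apply (is_derive_on_comp u v sin (fun r => lift r - lift t)); [easy | easy |].
  rewrite Rminus_diag. apply is_derive_Reals, derivable_pt_lim_sin. }
assert (DC : is_derive_on u v (fun r => cos (lift r - lift t)) t (snd w * - sin 0)).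
{ apply (is_derive_on_comp u v cos (fun r => lift r - lift t)); [easy | easy |].
  rewrite Rminus_diag. apply is_derive_Reals, derivable_pt_lim_cos. }
destruct (HL s0 Hs0) as [Gs0 _].
pose proof (locally_singleton _ _ El Ht) as Elt. simpl in Elt.
rewrite Et, Gs0 in Elt. simpl in Elt.
(* [K] is the sum of the local Lipschitz constants at [t] of the momentum and of the sine of the
   angle increment. The two error terms below then cost half of [eps] each. *)
pose (K := (Rabs (fst w) + 1) + (Rabs (snd w) + 1)).
assert (PK : 0 < K) by (unfold K; pose proof (Rabs_pos (fst w)); pose proof (Rabs_pos (snd w)); lra).
apply is_derive_on_of_eps; [easy |]. intros eps. pose proof (cond_pos eps) as Pe.
destruct (descent_estimate gamma T p a F G c s0 (eps / (2 * K)) HL Hreg Hs0) as [d Hd].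
{ intros s Hs E. split; [| now apply HG]. rewrite <- !Hg, E; easy. }
{ apply Rdiv_lt_0_compat; lra. }
assert (P2 : 0 < d / 2) by (pose proof (cond_pos d); lra).
assert (Pc : 0 < eps / (2 * (Rabs c + 1))).
{ pose proof (Rabs_pos c). apply Rdiv_lt_0_compat; lra. }
unfold within in El.
generalize (filter_and _ _ El (filter_and _ _
  (filter_and _ _ (is_derive_on_near u v _ t _ (mkposreal _ P2) Ht Dp)
    (is_derive_on_near u v _ t _ (mkposreal _ P2) Ht DC))
  (filter_and _ _ (is_derive_on_eps u v _ t _ Ht DS (mkposreal _ Pc))
  (filter_and _ _ (is_derive_on_lipschitz u v _ t _ Ht Dp)
    (is_derive_on_lipschitz u v _ t _ Ht DS))))).
apply filter_imp. intros r [E1 [[E2 E3] [E4 [E5 E6]]]] Ir.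
specialize (E1 Ir); specialize (E2 Ir); specialize (E3 Ir);
  specialize (E4 Ir); specialize (E5 Ir); specialize (E6 Ir).
simpl in E2, E3.
change (Rabs (sin (lift r - lift t) - sin (lift t - lift t) - (r - t) * snd w)
  <= eps / (2 * (Rabs c + 1)) * Rabs (r - t)) in E4.
change (Rabs (g (sigma r) - g (sigma t) - (r - t) * (c * snd w)) <= eps * Rabs (r - t)).
(* The parameter [s] is chosen separately for each [r] and may jump, for instance between [0] and
   [T]. *)
destruct (Him r Ir) as [s [Is Es]]. destruct (HL s Is) as [Gs _].
rewrite Es, Et, !Hg by easy. rewrite Es, Gs in E1, E2, E5. rewrite Et, Gs0 in E2, E5.
simpl in E1, E2, E5.
destruct (sin_cos_minus_angle _ _ _ _ E1 Elt) as [Q1 Q2].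
rewrite Rminus_diag in E3, E4, E6.
rewrite cos_0, <- Q2 in E3. rewrite sin_0, Rminus_0_r, <- Q1 in E4, E6.
specialize (Hd s Is). rewrite Rabs_minus_sym in E3.
pose proof (Rle_abs (1 - cos (a s - a s0))).
specialize (Hd ltac:(lra)).
replace (G s - G s0 - (r - t) * (c * snd w)) with
  ((G s - G s0 - c * sin (a s - a s0)) + c * (sin (a s - a s0) - (r - t) * snd w)) by ring.
eapply Rle_trans; [apply Rabs_triang |]. rewrite Rabs_mult.
assert (B1 : eps / (2 * K) * (Rabs (p s - p s0) + Rabs (sin (a s - a s0))) <=
  eps / 2 * Rabs (r - t)).
{ replace (eps / 2 * Rabs (r - t)) with (eps / (2 * K) * (K * Rabs (r - t))) by (field; lra).
  apply Rmult_le_compat_l; [apply Rlt_le, Rdiv_lt_0_compat; lra |]. unfold K. lra. }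
assert (B2 : Rabs c * Rabs (sin (a s - a s0) - (r - t) * snd w) <= eps / 2 * Rabs (r - t)).
{ pose proof (Rabs_pos c). pose proof (Rabs_pos (r - t)).
  replace (eps / 2 * Rabs (r - t)) with
    ((Rabs c + 1) * (eps / (2 * (Rabs c + 1)) * Rabs (r - t))) by (field; lra).
  pose proof (Rabs_pos (sin (a s - a s0) - (r - t) * snd w)). nra. }
lra.
Qed.

(** * Holonomy *)

Lemma descends (gamma : R -> TS1) (T : R) (G : R -> R) :
  (forall s t, 0 <= s <= T -> 0 <= t <= T -> gamma s = gamma t -> G s = G t) ->
  exists g : TS1 -> R, forall s, 0 <= s <= T -> g (gamma s) = G s.
Proof.
intros H. exists (fun x => G (epsilon (inhabits 0) (fun s => 0 <= s <= T /\ x = gamma s))).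
intros s Hs. assert (E : exists r, 0 <= r <= T /\ gamma s = gamma r) by now exists s.
destruct (epsilon_spec (inhabits 0) _ E) as [I1 I2]. symmetry. now apply H.
Qed.

(** [gc] and [gs] are the cosine and sine of [F / hbar] carried over to the image; the hypothesis on
    [F T] makes the values at [0] and [T] agree. The derivative formulas are the real and imaginary
    parts of the equation for horizontal sections. *)
Lemma flat_phase (hbar : R) (gamma : R -> TS1) (T : R) (p a F : R -> R) (n : Z) :
  0 < hbar -> periodic_integral_curve X_H gamma T -> pendulum_lift gamma T p a F ->
  F 0 = 0 -> F T = 2 * PI * (IZR n * hbar) ->
  exists gc gs : TS1 -> R,
    (forall x, im gamma T x -> gc x ^ 2 + gs x ^ 2 = 1) /\
    (forall sigma u v t w, u <= t <= v -> (forall r, u <= r <= v -> im gamma T (sigma r)) ->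
      has_velocity u v sigma t w ->
      is_derive_on u v (fun r => gc (sigma r)) t (- (theta (sigma t) w / hbar) * gs (sigma t)) /\
      is_derive_on u v (fun r => gs (sigma r)) t (theta (sigma t) w / hbar * gc (sigma t))).
Proof.
intros Hh Hg HL F0 FT.
assert (W1 : forall s t, 0 <= s -> s < t -> t <= T -> gamma s = gamma t ->
  sin (F t / hbar) = sin (F s / hbar) /\ cos (F t / hbar) = cos (F s / hbar)).
{ intros s t Hs Hst Ht E.
  destruct (periodic_curve_injective gamma T p a F s t Hg HL Hs Hst Ht E) as [-> ->].
  rewrite F0, FT. replace (2 * PI * (IZR n * hbar) / hbar) with (0 / hbar + 2 * PI * IZR n)
    by (field; lra).
  apply sin_cos_2kPI. }
assert (W : forall s t, 0 <= s <= T -> 0 <= t <= T -> gamma s = gamma t ->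
  sin (F t / hbar) = sin (F s / hbar) /\ cos (F t / hbar) = cos (F s / hbar)).
{ intros s t Hs Ht E. destruct (total_order_T s t) as [[L | ->] | L].
  - apply W1; easy || lra.
  - easy.
  - destruct (W1 t s) as [-> ->]; easy || lra. }
destruct (descends gamma T (fun s => cos (F s / hbar))) as [gc Hc].
{ intros. symmetry. now apply W. }
destruct (descends gamma T (fun s => sin (F s / hbar))) as [gs Hs].
{ intros. symmetry. now apply W. }
exists gc, gs. split.
- intros x [s [Is ->]]. rewrite Hc, Hs by easy.
  pose proof (sin2_cos2 (F s / hbar)) as S. unfold Rsqr in S. lra.
- intros sigma u v t w Ht Him Hw.
  assert (Hreg : forall s, 0 <= s <= T -> sin (a s) <> 0 \/ p s <> 0).
  { intros s Is. now apply (periodic_curve_regular gamma T p a F). }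
  destruct (Him t Ht) as [s0 [Is0 Es0]]. destruct (HL s0 Is0) as [G0 _].
  (* The point may be reached at both [0] and [T]. Momentum depends only on the point, so one
     coefficient serves every preimage. *)
  assert (EP : forall s, 0 <= s <= T -> gamma s = gamma s0 -> p s = p s0).
  { intros s Is E. destruct (HL s Is) as [Gs _]. rewrite Gs, G0 in E.
    now apply pair_equal_spec in E. }
  assert (Eth : theta (sigma t) w = p s0 * snd w) by (unfold theta; now rewrite Es0, G0).
  rewrite Eth, Es0, Hc, Hs by easy. split.
  + replace (- (p s0 * snd w / hbar) * sin (F s0 / hbar))
      with (- (p s0 / hbar * sin (F s0 / hbar)) * snd w) by (field; lra).
    apply (is_derive_on_descent gamma T p a F gc _ _ s0 u v sigma t w HL Hreg Is0 Hc); try easy.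
    intros s Is E. destruct (HL s Is) as [_ [_ [_ DF]]].
    rewrite <- (EP s Is E). rewrite (proj1 (W s s0 Is Is0 E)).
    auto_derive; [eexists; exact DF |]. rewrite (Derive_eq F _ _ DF). unfold Rdiv. ring.
  + replace (p s0 * snd w / hbar * cos (F s0 / hbar))
      with (p s0 / hbar * cos (F s0 / hbar) * snd w) by (field; lra).
    apply (is_derive_on_descent gamma T p a F gs _ _ s0 u v sigma t w HL Hreg Is0 Hs); try easy.
    intros s Is E. destruct (HL s Is) as [_ [_ [_ DF]]].
    rewrite <- (EP s Is E). rewrite (proj2 (W s s0 Is Is0 E)).
    auto_derive; [eexists; exact DF |]. rewrite (Derive_eq F _ _ DF). unfold Rdiv. ring.
Qed.

Lemma parallel_iff (hbar : R) (x : TS1) (v : tangent) (z dz : C) :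
  0 < hbar ->
  (dz + connection_form hbar x v * z)%C = RtoC 0 <->
  fst dz = - (theta x v / hbar) * snd z /\ snd dz = theta x v / hbar * fst z.
Proof.
intros Hh.
assert (E : connection_form hbar x v = (0, - (theta x v / hbar))).
{ unfold connection_form. rewrite <- RtoC_inv by lra.
  unfold Ci, RtoC, Cmult, Copp; simpl. f_equal; field; lra. }
rewrite E. destruct dz as [d1 d2], z as [z1 z2]. unfold Cplus, Cmult, RtoC; simpl.
split; intros Q; [apply pair_equal_spec in Q | apply pair_equal_spec]; lra.
Qed.

(* The quantity is [z] times the conjugate of the flat phase [gc + i gs]. *)
Lemma horizontal_flat_phase (hbar : R) (sigma : R -> TS1) (z : R -> C) (gc gs : TS1 -> R)
    (D : TS1 -> Prop) :
  0 < hbar ->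
  (forall sigma u v t w, u <= t <= v -> (forall r, u <= r <= v -> D (sigma r)) ->
    has_velocity u v sigma t w ->
    is_derive_on u v (fun r => gc (sigma r)) t (- (theta (sigma t) w / hbar) * gs (sigma t)) /\
    is_derive_on u v (fun r => gs (sigma r)) t (theta (sigma t) w / hbar * gc (sigma t))) ->
  forall a b, piecewise (horizontal_on hbar sigma z) a b ->
  a < b /\ ((forall r, a <= r <= b -> D (sigma r)) ->
  fst (z b) * gc (sigma b) + snd (z b) * gs (sigma b) =
    fst (z a) * gc (sigma a) + snd (z a) * gs (sigma a) /\
  snd (z b) * gc (sigma b) - fst (z b) * gs (sigma b) =
    snd (z a) * gc (sigma a) - fst (z a) * gs (sigma a)).
Proof.
intros Hh HD a b P. induction P as [a b Hab [HC Hz] | a c b _ [L1 IH1] _ [L2 IH2]].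
- split; [easy |]. intros Him.
  (* The phase and [z] rotate at the common rate [k], so the derivatives of both quantities
     cancel. *)
  assert (DD : forall t, a <= t <= b -> exists k,
    is_derive_on a b (fun r => gc (sigma r)) t (- k * gs (sigma t)) /\
    is_derive_on a b (fun r => gs (sigma r)) t (k * gc (sigma t)) /\
    is_derive_on a b (fun r => fst (z r)) t (- k * snd (z t)) /\
    is_derive_on a b (fun r => snd (z r)) t (k * fst (z t))).
  { intros t Ht. exists (theta (sigma t) (velocity a b sigma t) / hbar).
    destruct (HD sigma a b t (velocity a b sigma t) Ht Him (proj1 HC t Ht)) as [D1 D2].
    destruct (Hz t Ht) as [dz [Dz Pz]]. apply is_derive_on_pair in Dz.
    apply parallel_iff in Pz; [| easy]. destruct Pz as [<- <-], Dz as [D3 D4]. easy. }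
  split.
  + apply (is_derive_on_zero_constant a b
      (fun r => fst (z r) * gc (sigma r) + snd (z r) * gs (sigma r))); [| lra].
    intros t Ht. destruct (DD t Ht) as [k [D1 [D2 [D3 D4]]]].
    pose proof (is_derive_on_plus _ _ _ _ _ _ _ Ht
      (is_derive_on_mult _ _ _ _ _ _ _ Ht D3 D1) (is_derive_on_mult _ _ _ _ _ _ _ Ht D4 D2)) as Q.
    simpl in Q. match type of Q with is_derive_on _ _ _ _ ?l => replace l with 0 in Q by ring end.
    exact Q.
  + apply (is_derive_on_zero_constant a b
      (fun r => snd (z r) * gc (sigma r) - fst (z r) * gs (sigma r))); [| lra].
    intros t Ht. destruct (DD t Ht) as [k [D1 [D2 [D3 D4]]]].
    pose proof (is_derive_on_minus _ _ _ _ _ _ _ Ht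
      (is_derive_on_mult _ _ _ _ _ _ _ Ht D4 D1) (is_derive_on_mult _ _ _ _ _ _ _ Ht D3 D2)) as Q.
    simpl in Q. match type of Q with is_derive_on _ _ _ _ ?l => replace l with 0 in Q by ring end.
    exact Q.
- split; [lra |]. intros Him.
  destruct IH1 as [E1 E2]; [intros; apply Him; lra |].
  destruct IH2 as [E3 E4]; [intros; apply Him; lra |]. split; congruence.
Qed.

(** * Explicit loops in the image and their horizontal lifts *)

Lemma continuous_on_pair (D : R -> Prop) (f : R -> tangent) (g h : R -> R) :
  (forall t, D t -> f t = (g t, h t)) ->
  (forall t, D t -> continuous g t) -> (forall t, D t -> continuous h t) ->
  continuous_on D (f : R -> prod_UniformSpace R_UniformSpace R_UniformSpace).
Proof.
intros E Cg Ch t Ht. rewrite (E t Ht).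
apply filterlim_locally. intros eps. unfold within.
generalize (filter_and _ _ (proj1 (filterlim_locally _ _) (Cg t Ht) eps)
  (proj1 (filterlim_locally _ _) (Ch t Ht) eps)).
apply filter_imp. intros s [B1 B2] Hs. rewrite (E s Hs). now split.
Qed.

(** An affine change of time covers the two arcs of a full turn and, with [kappa = 0], the constant
    loop. The constants [w] and [c] set the initial vector and phase. *)
Lemma horizontal_reparametrization (hbar : R) (gamma : R -> TS1) (T : R) (p a F : R -> R)
    (sigma : R -> TS1) (z : R -> C) (u v beta kappa c : R) (w : C) :
  0 < hbar -> pendulum_lift gamma T p a F -> u < v ->
  (forall s, u <= s <= v -> 0 <= beta + kappa * s <= T /\ sigma s = gamma (beta + kappa * s) /\
    z s = Cmult w (cos ((F (beta + kappa * s) - c) / hbar), sin ((F (beta + kappa * s) - c) / hbar))) ->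
  horizontal_on hbar sigma z u v.
Proof.
intros Hh HL Huv H.
assert (HV : forall t, u <= t <= v -> has_velocity u v sigma t
  (kappa * - sin (a (beta + kappa * t)), kappa * p (beta + kappa * t))).
{ intros t Ht. destruct (H t Ht) as [It _]. destruct (HL _ It) as [_ [Dp [Da _]]]. split; simpl.
  - apply is_derive_on_ext with (fun s => p (beta + kappa * s)); [easy | |].
    + intros s Hs. destruct (H s Hs) as [Is [-> _]]. now destruct (HL _ Is) as [-> _].
    + apply is_derive_is_derive_on; [easy |].
      auto_derive; [eexists; exact Dp | rewrite (Derive_eq p _ _ Dp); ring].
  - exists (fun s => a (beta + kappa * s)). split.
    + unfold within. apply filter_forall. intros s Hs. destruct (H s Hs) as [Is [-> _]].
      now destruct (HL _ Is) as [-> _].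
    + apply is_derive_is_derive_on; [easy |].
      auto_derive; [eexists; exact Da | rewrite (Derive_eq a _ _ Da); ring]. }
assert (EV : forall t, u <= t <= v -> velocity u v sigma t =
  (kappa * - sin (a (beta + kappa * t)), kappa * p (beta + kappa * t))).
{ intros t Ht. apply velocity_eq; auto. }
split; [split |].
- intros t Ht. rewrite EV; auto.
- apply (continuous_on_pair _ _ _ _ EV); intros t Ht;
    destruct (H t Ht) as [It _]; destruct (HL _ It) as [_ [Dp [Da _]]].
  + apply (ex_derive_continuous (fun t => kappa * - sin (a (beta + kappa * t)))).
    auto_derive. eexists; exact Da.
  + apply (ex_derive_continuous (fun t => kappa * p (beta + kappa * t))).
    auto_derive. eexists; exact Dp.
- intros t Ht. destruct (H t Ht) as [It [Es Ez]]. destruct (HL _ It) as [G [Dp [Da DF]]].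
  pose (k := theta (sigma t) (velocity u v sigma t) / hbar).
  exists (- k * snd (z t), k * fst (z t)). split.
  + apply is_derive_on_ext with (fun s => Cmult w (cos ((F (beta + kappa * s) - c) / hbar),
      sin ((F (beta + kappa * s) - c) / hbar))); [easy | |].
    * intros s Hs. now destruct (H s Hs) as [_ [_ ->]].
    * unfold k, theta. rewrite EV, Es, G, Ez by easy.
      apply is_derive_on_pair. simpl.
      split; (apply is_derive_is_derive_on; [easy |]);
      (auto_derive; [repeat split; eexists; exact DF |]);
      rewrite (Derive_eq F _ _ DF); unfold Rdiv, Rminus; ring.
  + apply parallel_iff; easy.
Qed.

Lemma piecewise_impl (P Q : R -> R -> Prop) (a b : R) :
  (forall u v, P u v -> Q u v) -> piecewise P a b -> piecewise Q a b.
Proof.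
intros H HP. induction HP.
- apply piecewise_one; auto.
- now apply piecewise_cat with c.
Qed.

Lemma scalL_lambda0 (z : C) (x : TS1) : scalL z (lambda0 x) = (z, x).
Proof. unfold scalL, lambda0; simpl. now rewrite Cmult_1_r. Qed.

Lemma fibre_ext (x : TS1) (u v : fibre x) : fst (proj1_sig u) = fst (proj1_sig v) -> u = v.
Proof.
intros E. apply eq_sig_hprop; [intros; apply proof_irrelevance |].
rewrite (surjective_pairing (proj1_sig u)), (surjective_pairing (proj1_sig v)), E.
now rewrite (proj2_sig u), (proj2_sig v).
Qed.

Lemma full_turn_holonomy (hbar : R) (gamma : R -> TS1) (T : R) (p a F : R -> R) (t0 : R)
    (g : fibre (gamma t0) -> fibre (gamma t0)) :
  0 < hbar -> pendulum_lift gamma T p a F -> gamma T = gamma 0 -> 0 <= t0 <= T -> F 0 = 0 ->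
  (forall u, fst (proj1_sig (g u)) =
     Cmult (fst (proj1_sig u)) (cos (F T / hbar), sin (F T / hbar))) ->
  holonomy_group hbar (im gamma T) (gamma t0) g.
Proof.
intros Hh HL HT Ht F0 Hg.
(* The loop runs along [gamma] from [t0] to [T] during the first half of [[0, 1]] and from [0] to
   [t0] during the second, each at constant speed. *)
pose (b1 := t0). pose (k1 := 2 * (T - t0)). pose (b2 := - t0). pose (k2 := 2 * t0).
pose (sigma := fun t => if Rle_dec t (/ 2) then gamma (b1 + k1 * t) else gamma (b2 + k2 * t)).
pose (cis := fun y => (cos (y / hbar), sin (y / hbar)) : C).
(* At time [/ 2] the parameter jumps from [T] to [0], and [F] from [F T] to [0]. The offset
   [F t0 - F T] of the second arc compensates this, and leaves the phase [F T] at time [1]. *)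
pose (z := fun (w : C) t => if Rle_dec t (/ 2) then Cmult w (cis (F (b1 + k1 * t) - F t0))
  else Cmult w (cis (F (b2 + k2 * t) - (F t0 - F T)))).
assert (R1 : forall t, 0 <= t <= / 2 -> 0 <= b1 + k1 * t <= T) by (unfold b1, k1; intros; nra).
assert (R2 : forall t, / 2 <= t <= 1 -> 0 <= b2 + k2 * t <= T) by (unfold b2, k2; intros; nra).
assert (S2 : forall t, / 2 <= t <= 1 -> sigma t = gamma (b2 + k2 * t) /\
  forall w, z w t = Cmult w (cis (F (b2 + k2 * t) - (F t0 - F T)))).
{ intros t Hr. unfold sigma, z. destruct (Rle_dec t (/ 2)) as [L |]; [| easy].
  assert (t = / 2) as -> by lra.
  replace (b1 + k1 * / 2) with T by (unfold b1, k1; field).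
  replace (b2 + k2 * / 2) with 0 by (unfold b2, k2; field).
  split; [easy |]. intros w. do 2 f_equal. lra. }
assert (H : forall w, piecewise (horizontal_on hbar sigma (z w)) 0 1).
{ intros w. apply piecewise_cat with (/ 2).
  - apply piecewise_one; [lra |].
    apply (horizontal_reparametrization hbar gamma T p a F sigma (z w) _ _ b1 k1 (F t0) w);
      try easy; [lra |].
    intros s Hs. split; [now apply R1 |]. unfold sigma, z.
    destruct (Rle_dec s (/ 2)); [easy | lra].
  - apply piecewise_one; [lra |].
    apply (horizontal_reparametrization hbar gamma T p a F sigma (z w) _ _ b2 k2 (F t0 - F T) w);
      try easy; [lra |].
    intros s Hs. destruct (S2 s Hs) as [E1 E2]. split; [now apply R2 | easy]. }
assert (E0 : sigma 0 = gamma t0).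
{ unfold sigma. destruct (Rle_dec 0 (/ 2)); [| lra]. f_equal. unfold b1, k1. ring. }
destruct (S2 1) as [E1 Z1]; [lra |].
replace (b2 + k2 * 1) with t0 in E1, Z1 by (unfold b2, k2; ring).
exists sigma. split; [split; [| split; [| easy]] |].
(* Horizontality includes that the base curve is [C1_on], so any lift, here the zero one, shows that
   the loop is piecewise of class C1. *)
- apply piecewise_impl with (horizontal_on hbar sigma (z 0)); [| apply H]. now intros u v [].
- intros t Hr. destruct (Rle_dec t (/ 2)) as [L | L].
  + exists (b1 + k1 * t). split; [apply R1; lra |]. unfold sigma.
    now destruct (Rle_dec t (/ 2)).
  + exists (b2 + k2 * t). split; [apply R2 | apply S2]; lra.
- intros u. exists (z (fst (proj1_sig u))). split; [apply H |].
  rewrite !scalL_lambda0, E0, E1, Z1. split.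
  + rewrite (surjective_pairing (proj1_sig u)) at 1. rewrite (proj2_sig u). f_equal.
    unfold z. destruct (Rle_dec 0 (/ 2)); [| lra].
    replace (F (b1 + k1 * 0) - F t0) with 0 by (unfold b1, k1; rewrite Rmult_0_r, Rplus_0_r; ring).
    unfold cis, Rdiv. rewrite Rmult_0_l, cos_0, sin_0. symmetry. apply Cmult_1_r.
  + rewrite (surjective_pairing (proj1_sig (g u))), (proj2_sig (g u)), Hg.
    do 2 f_equal. unfold cis. now replace (F t0 - (F t0 - F T)) with (F T) by ring.
Qed.

Lemma constant_loop_holonomy (hbar : R) (gamma : R -> TS1) (T : R) (p a F : R -> R) (t0 : R) :
  0 < hbar -> pendulum_lift gamma T p a F -> 0 <= t0 <= T ->
  holonomy_group hbar (im gamma T) (gamma t0) (fun u => u).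
Proof.
intros Hh HL Ht.
assert (H : forall w, piecewise (horizontal_on hbar (fun _ => gamma t0) (fun _ => w)) 0 1).
{ intros w. apply piecewise_one; [lra |].
  apply (horizontal_reparametrization hbar gamma T p a F _ _ _ _ t0 0 (F t0) w); try easy; [lra |].
  intros s _. rewrite Rmult_0_l, Rplus_0_r, Rminus_diag. unfold Rdiv.
  rewrite Rmult_0_l, cos_0, sin_0. split; [easy |]. split; [easy |]. symmetry. apply Cmult_1_r. }
exists (fun _ => gamma t0). split; [split; [| split; [| easy]] |].
- apply piecewise_impl with (horizontal_on hbar (fun _ => gamma t0) (fun _ => 0%C)); [| apply H].
  now intros u v [].
- intros _ _. now exists t0.
- intros u. exists (fun _ => fst (proj1_sig u)). split; [apply H |].
  split; rewrite scalL_lambda0, (surjective_pairing (proj1_sig u)) at 1; simpl;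
    now rewrite (proj2_sig u).
Qed.

Theorem theorem4p1 (hbar : R) (Hhbar : 0 < hbar)
    (gamma : R -> TS1) (T : R) (Hgamma : periodic_integral_curve X_H gamma T)
    (x : TS1) (Hx : im gamma T x) :
  trivial_holonomy hbar (im gamma T) x <->
  exists n : Z, action gamma T = IZR n * hbar.
Proof.
destruct Hx as [t0 [It ->]].
destruct (Hgamma) as [HX [_ [[[HT _] HP] _]]].
destruct (integral_curve_lift gamma T HT HX) as [p [a [F [HL [F0 FT]]]]].
assert (HC : gamma T = gamma 0).
{ rewrite <- (HP 0) by lra. now rewrite Rplus_0_l. }
split.
- intros Htriv.
  pose (cis := (cos (F T / hbar), sin (F T / hbar)) : C).
  pose (g := fun u : fibre (gamma t0) =>
    exist (fun l : L => snd l = gamma t0) (Cmult (fst (proj1_sig u)) cis, gamma t0) eq_refl).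
  assert (E : g = (fun u => u)).
  { apply Htriv, (full_turn_holonomy hbar gamma T p a F); easy. }
  (* Evaluating at the unit vector gives [exp (i F T / hbar) = 1]. Its real part already forces
     [F T / hbar] to be a multiple of [2 * PI]. *)
  apply (f_equal (fun h => fst (proj1_sig
    (h (exist (fun l : L => snd l = gamma t0) (RtoC 1, gamma t0) eq_refl))))) in E.
  simpl in E. rewrite Cmult_1_l in E. apply pair_equal_spec in E. destruct E as [E _].
  apply cos_eq_1 in E. destruct E as [k E]. exists k.
  apply (Rmult_eq_reg_l (2 * PI)); [| pose proof PI_neq0; lra].
  rewrite <- FT, <- Rmult_assoc, <- E. field. lra.
- intros [n Hn] g. split; [| intros ->; now apply (constant_loop_holonomy _ _ _ p a F)].
  intros [sigma [[_ [Him [E0 E1]]] Hpt]].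
  apply functional_extensionality. intros u. apply fibre_ext.
  destruct (Hpt u) as [z [Pz [Eu Eg]]]. rewrite scalL_lambda0 in Eu, Eg. rewrite Eu, Eg. simpl.
  rewrite Hn in FT.
  destruct (flat_phase hbar gamma T p a F n Hhbar Hgamma HL F0 FT) as [gc [gs [N D]]].
  destruct (horizontal_flat_phase hbar sigma z gc gs _ Hhbar D 0 1 Pz) as [_ Q].
  destruct (Q Him) as [Q1 Q2]. rewrite E0, E1 in Q1, Q2.
  assert (N1 : gc (gamma t0) ^ 2 + gs (gamma t0) ^ 2 = 1) by (apply N; now exists t0).
  set (c := gc (gamma t0)) in *. set (s := gs (gamma t0)) in *.
  rewrite (surjective_pairing (z 1)), (surjective_pairing (z 0)).
  set (x1 := fst (z 1)) in *. set (y1 := snd (z 1)) in *.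
  set (x0 := fst (z 0)) in *. set (y0 := snd (z 0)) in *.
  f_equal.
  (* [Q1] and [Q2] say that [z 1] and [z 0] have the same product with the conjugate of [c + i s].
     Multiplying back by [c + i s], of modulus one by [N1], gives [z 1 = z 0]; this is the real
     part. *)
  + replace x1 with ((x1 * c + y1 * s) * c - (y1 * c - x1 * s) * s + x1 * (1 - (c ^ 2 + s ^ 2)))
      by ring.
    rewrite Q1, Q2, N1. replace x0 with (x0 * (c ^ 2 + s ^ 2)) at 3 by (rewrite N1; ring). ring.
  + replace y1 with ((x1 * c + y1 * s) * s + (y1 * c - x1 * s) * c + y1 * (1 - (c ^ 2 + s ^ 2)))
      by ring.
    rewrite Q1, Q2, N1. replace y0 with (y0 * (c ^ 2 + s ^ 2)) at 3 by (rewrite N1; ring). ring.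
Qed.
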